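(* Let $\Gamma$ be a group. Then $\Gamma$ is universally boundedly acyclic if and only if $\operatorname{H}^n_b(\Gamma;\mathbb{R}) \cong 0$ for all $n \geq 1$ and $\operatorname{H}_n(\Gamma;\mathbb{Z}) \cong 0$ for all $n \geq 1$.
   Context: A complete valued field is a field $\mathbb{K}$ with an absolute value (multiplicative, $|x|=0$ iff $x=0$, triangle inequality) whose induced metric is complete. For such $\mathbb{K}$, $\operatorname{H}^*_b(\Gamma;\mathbb{K})$ is the cohomology of the complex of $\Gamma$-invariant (diagonal action) bounded functions $\Gamma^{n+1} \to \mathbb{K}$ with the homogeneous coboundary. $\Gamma$ is $\mathbb{K}$-boundedly acyclic if $\operatorname{H}^n_b(\Gamma;\mathbb{K}) \cong 0$ for all $n\ge 1$, and universally boundedly acyclic if it is $\mathbb{K}$-boundedly acyclic for every complete valued field $\mathbb{K}$. *)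

(* Defs.v *)
From HB Require Import structures.
From mathcomp Require Import all_boot all_order all_algebra.
From mathcomp Require Import boolp.
From mathcomp Require Import Rstruct.

Set Implicit Arguments.
Unset Strict Implicit.
Unset Printing Implicit Defensive.

Import Order.TTheory GRing.Theory Num.Theory.
Local Open Scope ring_scope.

Notation R := Rdefinitions.R.

Record group := Group {
  gcar :> Type;
  gmul : gcar -> gcar -> gcar;
  ginv : gcar -> gcar;
  gone : gcar;
  gmulA : forall x y z, gmul x (gmul y z) = gmul (gmul x y) z;
  gmul1 : forall x, gmul gone x = x;
  gmulV : forall x, gmul (ginv x) x = gone
}.

Definition is_absolute_value (K : fieldType) (a : K -> R) : Prop :=
  [/\ forall x, 0 <= a x,
      forall x, a x = 0 <-> x = 0,
      forall x y, a (x * y) = a x * a y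
    & forall x y, a (x + y) <= a x + a y].

Definition abs_complete (K : fieldType) (a : K -> R) : Prop :=
  forall u : nat -> K,
    (forall eps : R, 0 < eps -> exists N : nat,
        forall p q : nat, (N <= p)%N -> (N <= q)%N -> a (u p - u q) < eps) ->
    exists l : K, forall eps : R, 0 < eps -> exists N : nat,
        forall n : nat, (N <= n)%N -> a (u n - l) < eps.

Definition cochain (G : group) (K : Type) (n : nat) := ('I_n.+1 -> G) -> K.

Definition cochain_invariant (G : group) (K : Type) (n : nat)
  (f : cochain G K n) : Prop :=
  forall (g : G) (x : 'I_n.+1 -> G), f (fun j => gmul g (x j)) = f x.

Definition cochain_bounded (G : group) (K : Type) (a : K -> R) (n : nat)
  (f : cochain G K n) : Prop :=
  exists C : R, forall x : 'I_n.+1 -> G, a (f x) <= C.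

Definition coboundary (G : group) (K : fieldType) (n : nat)
  (f : cochain G K n) : cochain G K n.+1 :=
  fun x => \sum_(i < n.+2) (-1) ^+ i * f (fun j => x (lift i j)).

(* H^n_b(G;K) = 0 for n = m+1 >= 1 : every bounded invariant cocycle is the
   coboundary of a bounded invariant cochain *)
Definition bcoh_vanishes (G : group) (K : fieldType) (a : K -> R) (m : nat)
  : Prop :=
  forall f : cochain G K m.+1,
    cochain_invariant f -> cochain_bounded a f ->
    (forall x, coboundary f x = 0) ->
    exists h : cochain G K m,
      [/\ cochain_invariant h, cochain_bounded a h
        & forall x, f x = coboundary h x].

Definition boundedly_acyclic (G : group) (K : fieldType) (a : K -> R) : Prop :=
  forall m : nat, bcoh_vanishes G a m.

Definition universally_boundedly_acyclic (G : group) : Prop :=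
  forall (K : fieldType) (a : K -> R),
    is_absolute_value a -> abs_complete a -> boundedly_acyclic G a.

(* Integral group homology via the inhomogeneous (bar) complex          *)
(* C_n = Z[Gamma^n], chains represented as formal sums (lists)          *)
Definition chain (G : group) (n : nat) := seq (int * ('I_n -> G)).

Definition coef (G : group) (n : nat) (c : chain G n) (x : 'I_n -> G) : int :=
  \sum_(p <- c) (if `[< p.2 = x >] then p.1 else 0).

(* i-th face  Gamma^(m+1) -> Gamma^m , i = 0..m+1:
   d_0 (g_0..g_m) = (g_1..g_m),
   d_i (g_0..g_m) = (g_0..g_(i-1) g_i..g_m)    (0 < i <= m),
   d_(m+1) (g_0..g_m) = (g_0..g_(m-1)). *)
Definition face (G : group) (m : nat) (i : 'I_m.+2) (g : 'I_m.+1 -> G)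
  : 'I_m -> G :=
  fun j => if (j.+1 < i)%N then g (widen_ord (leqnSn m) j)
           else if (j.+1 == i)%N then gmul (g (widen_ord (leqnSn m) j))
                                           (g (lift ord0 j))
           else g (lift ord0 j).

Definition boundary (G : group) (m : nat) (c : chain G m.+1) : chain G m :=
  flatten [seq [seq ((((-1) ^+ i * p.1)%R : int), face i p.2)
                | i : 'I_m.+2 <- enum 'I_m.+2]
          | p : int * ('I_m.+1 -> G) <- c].

(* H_n(G;Z) = 0 for n = m+1 >= 1 *)
Definition hom_vanishes (G : group) (m : nat) : Prop :=
  forall c : chain G m.+1,
    (forall x, coef (boundary c) x = 0) ->
    exists b : chain G m.+2, forall x, coef (boundary b) x = coef c x.

Definition integrally_acyclic (G : group) : Prop :=
  forall m : nat, hom_vanishes G m.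

Definition Rabsval : R -> R := fun x => `|x|.

(* Main.v *)
From HB Require Import structures.
Require Import Defs.
From mathcomp Require Import all_boot all_order all_algebra.
From mathcomp Require Import boolp classical_sets functions reals.
From mathcomp Require Import topology normedtype derive.
From mathcomp Require Import Rstruct.
From mathcomp Require complex.
From mathcomp Require Import zify ring lra.

(** For the trivial absolute value every cochain is bounded, so universal
    bounded acyclicity kills the cohomology, hence (separating a cycle from the
    boundaries by a linear functional) the homology of [G] over [Q] and over
    every [F_p].  The first makes each integral cycle torsion modulo
    boundaries, and the second removes the torsion one prime at a time.

    Conversely, an integrally acyclic [G] has a contractible bar complex in
    positive degrees, so every bar cocycle has a primitive whose values are
    integral combinations of its own values.  Over a non-archimedean field this
    primitive satisfies the same bound as the cocycle.  An archimedean complete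
    field is a copy of the reals or of the complex numbers by the
    Ostrowski-Gelfand-Mazur theorem, and the real coordinates of a bounded
    cocycle are bounded real cocycles. *)

Set Implicit Arguments.
Unset Strict Implicit.
Unset Printing Implicit Defensive.

Import Order.TTheory GRing.Theory Num.Theory.
Import numFieldNormedType.Exports.
Local Open Scope ring_scope.

(** * Homogeneous and bar cochains *)

Section Groups.
Variable G : group.
Implicit Types x y z : G.

Lemma gmulVl x y : gmul (ginv x) (gmul x y) = y.
Proof. by rewrite gmulA gmulV gmul1. Qed.

Lemma gmulI x y z : gmul x y = gmul x z -> y = z.
Proof. by move=> e; rewrite -(gmulVl x y) e gmulVl. Qed.

Lemma gmulr1 x : gmul x (gone G) = x.
Proof. by apply: (@gmulI (ginv x)); rewrite gmulVl gmulV. Qed.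

Lemma gmulrV x : gmul x (ginv x) = gone G.
Proof. by apply: (@gmulI (ginv x)); rewrite gmulVl gmulr1. Qed.

Lemma gmulVr x y : gmul x (gmul (ginv x) y) = y.
Proof. by rewrite gmulA gmulrV gmul1. Qed.

Lemma ginvM x y : ginv (gmul x y) = gmul (ginv y) (ginv x).
Proof.
by apply: (@gmulI (gmul x y)); rewrite gmulrV -gmulA gmulVr gmulrV.
Qed.

End Groups.

Section Translation.
Variable G : group.

(* The bar simplex of a homogeneous one; [walk] is the inverse whose first
   vertex is [1]. *)
Definition steps n (x : 'I_n.+1 -> G) : 'I_n -> G :=
  fun j => gmul (ginv (x (widen_ord (leqnSn n) j))) (x (lift ord0 j)).

Fixpoint prefix_prod (g : nat -> G) (j : nat) : G :=
  if j is j'.+1 then gmul (prefix_prod g j') (g j') else gone G.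

Definition walk n (g : 'I_n -> G) : 'I_n.+1 -> G :=
  fun j => prefix_prod (fun k => oapp g (gone G) (insub k)) j.

Lemma face_steps m (i : 'I_m.+2) (x : 'I_m.+2 -> G) :
  face i (steps x) = steps (fun j => x (lift i j)).
Proof.
apply: funext => j; rewrite /face /steps.
case: ltngtP => ji.
- congr (gmul (ginv (x _)) (x _)); apply: val_inj;
  rewrite /= /bump; lia.
- congr (gmul (ginv (x _)) (x _)); apply: val_inj;
  rewrite /= /bump; lia.
- rewrite -gmulA.
  have -> : widen_ord (leqnSn m.+1) (lift ord0 j)
     = lift ord0 (widen_ord (leqnSn m) j) by apply: val_inj.
  rewrite gmulVr.
  congr (gmul (ginv (x _)) (x _)); apply: val_inj;
  rewrite /= /bump; lia.
Qed.

Lemma walkK n (g : 'I_n -> G) : steps (walk g) = g.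
Proof.
apply: funext => j; rewrite /steps /walk /= gmulVl.
by rewrite -[in insub _](_ : nat_of_ord j = 0 + j)%N // valK.
Qed.

Lemma walk_steps n (x : 'I_n.+1 -> G) j :
  walk (steps x) j = gmul (ginv (x ord0)) (x j).
Proof.
case: j => j; elim: j => [|j IH] hj; rewrite /walk /=.
  by rewrite (_ : Ordinal hj = ord0) ?gmulV //; exact: val_inj.
have hj' : (j < n.+1)%N by lia.
have := IH hj'; rewrite /walk /= => ->.
rewrite insubT //= /steps -gmulA.
rewrite (_ : widen_ord _ _ = Ordinal hj'); last exact: val_inj.
by rewrite gmulVr; congr (gmul _ (x _)); apply: val_inj.
Qed.

Lemma steps_mul n g (x : 'I_n.+1 -> G) :
  steps (fun j => gmul g (x j)) = steps x.
Proof. by apply: funext => j; rewrite /steps ginvM -gmulA gmulVl. Qed.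

Lemma invariant_walk (K : Type) n (f : cochain G K n) x :
  cochain_invariant f -> f (walk (steps x)) = f x.
Proof.
move=> fI; rewrite -(fI (ginv (x ord0)) x); congr f.
by apply: funext => j; rewrite walk_steps.
Qed.

(** Values lie in an arbitrary abelian group, so that one formula serves integer, real and
    [K]-valued cochains and the universal primitive below. *)
Definition bar_coboundary (V : zmodType) m (F : ('I_m -> G) -> V)
    (g : 'I_m.+1 -> G) : V :=
  \sum_(i < m.+2) F (face i g) *~ (-1) ^+ i.

Lemma coboundary_steps (K : fieldType) m (F : ('I_m -> G) -> K)
    (x : 'I_m.+2 -> G) :
  coboundary (fun y => F (steps y)) x = bar_coboundary F (steps x).
Proof.
apply: eq_bigr => i _; rewrite face_steps.
by rewrite -mulrzl rmorphXn rmorphN1.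
Qed.

End Translation.

Section BarCriterion.
Variables (G : group) (K : fieldType) (a : K -> R) (m : nat).

(** An invariant cochain is determined by its values on tuples starting at [1]. Composition with
    [steps] and [walk] therefore passes between the two complexes, and it keeps every bound because
    it only reindexes values. *)
Lemma bcoh_vanishes_bar :
  bcoh_vanishes G a m <->
  forall F : ('I_m.+1 -> G) -> K, (exists C, forall g, a (F g) <= C) ->
    (forall g, bar_coboundary F g = 0) ->
    exists2 H : ('I_m -> G) -> K, exists C, forall g, a (H g) <= C
      & forall g, F g = bar_coboundary H g.
Proof.
split=> van.
  move=> F [C FC] F0.
  have [] := van (fun x => F (steps x)).
  - by move=> g x; rewrite steps_mul.
  - by exists C => x.
  - by move=> x; rewrite coboundary_steps.
  move=> h [hI [D hD] hF]; exists (fun g => h (walk g)).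
    by exists D => g.
  move=> g; rewrite -{1}(walkK g) hF -{2}(walkK g) -coboundary_steps.
  by apply: eq_bigr => i _; rewrite invariant_walk.
move=> f fI [C fC] f0.
have [||H [D HD] HF] := van (fun g => f (walk g)).
- by exists C.
- move=> g; rewrite -(walkK g) -coboundary_steps -[RHS](f0 (walk g)).
  by apply: eq_bigr => i _; rewrite invariant_walk.
exists (fun x => H (steps x)); split.
- by move=> g x; rewrite steps_mul.
- by exists D.
- by move=> x; rewrite coboundary_steps -HF invariant_walk.
Qed.

End BarCriterion.

(** * Index arithmetic of deleting two vertices in either order *)

Section SwapDeletions.
Local Open Scope nat_scope.
Variables i j : nat.

(** The position of vertex [i] among those left once vertex [bump i j] has been deleted. *)
Definition swap_index : nat := if j < i then i.-1 else i.

Lemma bump_swap_index : bump (bump i j) swap_index = i.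
Proof. rewrite /swap_index /bump; case: (leqP i j) => ij /=; lia. Qed.

Lemma bump_swap_indexK :
  (if swap_index < bump i j then (bump i j).-1 else bump i j) = j.
Proof.
rewrite /swap_index /bump; case: (leqP i j) => ij /=; first by rewrite ltnS ij.
by rewrite add0n ltnNge -ltnS (ltn_predK ij) ij.
Qed.

Lemma bump_bump_swap k :
  bump (bump i j) (bump swap_index k) = bump i (bump j k).
Proof. rewrite /swap_index /bump; case: (leqP i j) => ij /=; lia. Qed.

Lemma odd_bump_swap : odd (bump i j + swap_index) = ~~ odd (i + j).
Proof.
rewrite /swap_index /bump; case: (leqP i j) => ij.
  by rewrite (_ : true + j = j.+1) // addSn /= addnC.
by rewrite add0n -{2}(ltn_predK ij) addSn /= negbK addnC.
Qed.

End SwapDeletions.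

(** * Formal chains and their pairing with cochains *)

Section Chains.
Variable G : group.

(** The additive extension of [F] to formal sums; [lin] below is its analogue for chain-valued
    maps. *)
Definition ev (V : zmodType) n (F : ('I_n -> G) -> V) (c : chain G n) : V :=
  \sum_(p <- c) F p.2 *~ p.1.

Definition scale n (k : int) (c : chain G n) : chain G n :=
  [seq (k * p.1, p.2) | p <- c].

Definition lin m n (s : ('I_m -> G) -> chain G n) (c : chain G m) :
  chain G n := flatten [seq scale p.1 (s p.2) | p <- c].

Definition pt n (x : 'I_n -> G) : chain G n := [:: (1, x)].

Lemma ev_cat (V : zmodType) n (F : ('I_n -> G) -> V) c d :
  ev F (c ++ d) = ev F c + ev F d.
Proof. by rewrite /ev big_cat. Qed.

Lemma ev_scale (V : zmodType) n (F : ('I_n -> G) -> V) k c :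
  ev F (scale k c) = ev F c *~ k.
Proof.
rewrite /ev big_map mulrz_suml; apply: eq_bigr => p _ /=.
by rewrite mulrC mulrzA.
Qed.

Lemma ev_pt (V : zmodType) n (F : ('I_n -> G) -> V) x : ev F (pt x) = F x.
Proof. by rewrite /ev big_seq1. Qed.

Lemma ev_lin (V : zmodType) m n (F : ('I_n -> G) -> V)
    (s : ('I_m -> G) -> chain G n) c :
  ev F (lin s c) = ev (fun x => ev F (s x)) c.
Proof.
elim: c => [|p c IH]; first by rewrite /ev !big_nil.
by rewrite /lin /= ev_cat ev_scale -/(lin s c) IH /ev big_cons.
Qed.

Lemma ev_boundary (V : zmodType) m (F : ('I_m -> G) -> V) c :
  ev F (boundary c) = ev (bar_coboundary F) c.
Proof.
rewrite {1}/ev /boundary big_flatten big_map; apply: eq_bigr => p _.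
rewrite big_map mulrz_suml big_enum /=; apply: eq_bigr => i _.
by rewrite mulrzA.
Qed.

Definition dirac n (x y : 'I_n -> G) : int := if `[< y = x >] then 1 else 0.

Lemma coef_ev n (c : chain G n) x : coef c x = ev (dirac x) c.
Proof.
rewrite /coef /ev; apply: eq_bigr => p _; rewrite /dirac.
by case: ifP => _; rewrite ?mul0rz ?intz.
Qed.

Lemma coef_cat n (c d : chain G n) x : coef (c ++ d) x = coef c x + coef d x.
Proof. by rewrite !coef_ev ev_cat. Qed.

Lemma coef_scale n k (c : chain G n) x : coef (scale k c) x = k * coef c x.
Proof. by rewrite !coef_ev ev_scale mulrzz mulrC. Qed.

Lemma coef_boundary_cat m (c d : chain G m.+1) x :
  coef (boundary (c ++ d)) x = coef (boundary c) x + coef (boundary d) x.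
Proof. by rewrite !coef_ev !ev_boundary ev_cat. Qed.

Lemma coef_boundary_scale m k (c : chain G m.+1) x :
  coef (boundary (scale k c)) x = k * coef (boundary c) x.
Proof. by rewrite !coef_ev !ev_boundary ev_scale mulrzz mulrC. Qed.

(** The type [{classic _}] supplies the decidable equality on tuples that [undup] requires. *)
Definition supp n (c : chain G n) : seq {classic ('I_n -> G)} :=
  undup ([seq p.2 | p <- c] : seq {classic ('I_n -> G)}).

Lemma ev_supp (V : zmodType) n (F : ('I_n -> G) -> V) c :
  ev F c = \sum_(x <- supp c) F x *~ coef c x.
Proof.
under eq_bigr do rewrite /coef mulrz_sumr.
rewrite exchange_big /=.
have : {subset ([seq p.2 | p <- c] : seq {classic ('I_n -> G)}) <= supp c}.
  by move=> x; rewrite mem_undup.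
(* The induction runs over the list being summed, while the index set [supp c] stays fixed. *)
elim: {1 3 4}c => [|p d IH] sub; first by rewrite /ev !big_nil.
rewrite /ev !big_cons -/(ev F d) IH; last first.
  by move=> x xd; apply: sub; rewrite /= in_cons xd orbT.
congr (_ + _); have ps := sub (p.2 : {classic _}) (mem_head _ _).
rewrite (bigD1_seq _ ps) ?undup_uniq //= asboolT // big1 ?addr0 // => x xp.
by rewrite asboolF // => e; rewrite e eqxx in xp.
Qed.

Lemma ev_eq0 (V : zmodType) n (F : ('I_n -> G) -> V) c :
  (forall x, F x *~ coef c x = 0) -> ev F c = 0.
Proof. by move=> c0; rewrite ev_supp big1. Qed.

(** Chains are compared only through [coef]; this makes evaluation well defined on the free abelian
    group. *)
Lemma ev_eq (V : zmodType) n (F : ('I_n -> G) -> V) c d :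
  (forall x, coef c x = coef d x) -> ev F c = ev F d.
Proof.
move=> cd; apply/eqP; rewrite -subr_eq0 -[- ev F d]mulrN1z -ev_scale -ev_cat.
by rewrite ev_eq0 // => x; rewrite coef_cat coef_scale mulN1r cd subrr.
Qed.

(* Removing repeated simplices makes each coefficient visible in the list. *)
Lemma chain_divide n (c : chain G n) (k : int) (q : ('I_n -> G) -> int) :
  (forall x, coef c x = k * q x) ->
  exists d, forall x, coef c x = k * coef d x.
Proof.
move=> ck; exists [seq (q x, x) | x <- supp c] => x.
rewrite coef_ev ev_supp [in RHS]/coef big_map mulr_sumr.
apply: eq_bigr => y _ /=.
rewrite ck /dirac; case: ifP => _; last by rewrite mul0rz mulr0.
by rewrite intz.
Qed.

Lemma bar_coboundary_sqr n (F : ('I_n -> G) -> int) (g : 'I_n.+2 -> G) :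
  bar_coboundary (bar_coboundary F) g = 0.
Proof.
(* In terms of the vertices [x], every face deletes one vertex. *)
rewrite -(walkK g); set x := walk g.
pose t (p : 'I_n.+3 * 'I_n.+2) : int :=
  F (steps (fun j => x (lift p.1 (lift p.2 j)))) *~ (-1) ^+ (p.1 + p.2).
have -> : bar_coboundary (bar_coboundary F) (steps x) = \sum_p t p.
  rewrite -(pair_bigA _ (fun i j => t (i, j))) /=.
  apply: eq_bigr => i _; rewrite mulrz_suml; apply: eq_bigr => j _.
  by rewrite !face_steps /t /= exprD mulrC mulrzA.
(* Deleting vertex [i] and then vertex [lift i j] of the rest can be done in
   the opposite order; the swap of orders is an involution changing signs. *)
pose swap (p : 'I_n.+3 * 'I_n.+2) : 'I_n.+3 * 'I_n.+2 :=
  (lift p.1 p.2, inord (swap_index p.1 p.2)).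
have vswap p : nat_of_ord (swap p).2 = swap_index p.1 p.2.
  rewrite inordK // /swap_index; case: p => [[i ?] [j ?]] /=.
  by case: ifP; lia.
have swapK : involutive swap.
  move=> p; apply: injective_projections; apply: val_inj.
    by rewrite [LHS]/= vswap bump_swap_index.
  by rewrite [LHS]vswap /swap_index vswap bump_swap_indexK.
have tswap p : t (swap p) = - t p.
  rewrite /t.
  have -> : (fun j => x (lift (swap p).1 (lift (swap p).2 j))) =
            (fun j => x (lift p.1 (lift p.2 j))).
    apply: funext => j; congr x; apply: val_inj.
    by rewrite [LHS]/= vswap bump_bump_swap.
  rewrite -mulrNz; congr (_ *~ _); rewrite vswap.
  rewrite -signr_odd -[in RHS]signr_odd -signrN.
  by rewrite [LHS]/= odd_bump_swap.
have : \sum_p t p = - \sum_p t p.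
  rewrite {1}(reindex_inj (inv_inj swapK)) /= -sumrN.
  by apply: eq_bigr => p _; rewrite tswap.
lia.
Qed.

Lemma coef_boundary_boundary n (c : chain G n.+2) x :
  coef (boundary (boundary c)) x = 0.
Proof.
rewrite coef_ev !ev_boundary ev_eq0 // => y.
by rewrite bar_coboundary_sqr mul0rz.
Qed.

End Chains.

(** * Contraction of the bar complex *)

Section Contraction.
Variable G : group.
Hypothesis acyc : integrally_acyclic G.

(* The bar complex is free, bounded below and, since [boundary] vanishes from
   degree 1 to degree 0, exact in positive degrees; so it contracts there. *)
Lemma bar_contraction n :
  exists (s : ('I_n -> G) -> chain G n.+1) (t : ('I_n.+1 -> G) -> chain G n.+2),
  forall g x, coef (boundary (t g)) x + coef (lin s (boundary (pt g))) x
              = coef (pt g) x.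
Proof.
elim: n => [|n [s [t st]]].
  exists (fun _ => [::]).
  suff /choice[t tP] : forall g : 'I_1 -> G, exists b : chain G 2,
      forall x, coef (boundary b) x = coef (pt g) x.
    exists t => g x; rewrite tP -[RHS]addr0; congr (_ + _).
    by rewrite coef_ev ev_lin ev_eq0 // => y; rewrite /ev big_nil mul0rz.
  move=> g; apply: acyc => x.
  rewrite coef_ev ev_boundary ev_pt /bar_coboundary !big_ord_recl big_ord0.
  have -> : face (lift ord0 ord0) g = face ord0 g by apply: funext => -[].
  by rewrite addr0 expr0 expr1 mulrN1z mulr1z subrr.
exists t.
(* The chain [g - t (boundary g)] is a cycle by the identity in the previous degree; a filling of it
   is the next value of the homotopy. *)
suff /choice[u uP] : forall g : 'I_n.+2 -> G, exists b : chain G n.+3,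
    forall x, coef (boundary b) x
      = coef (pt g ++ scale (- 1) (lin t (boundary (pt g)))) x.
  by exists u => g x; rewrite uP coef_cat coef_scale mulN1r subrK.
move=> g; apply: acyc => x.
have st_lin (c : chain G n.+1) y :
    coef (boundary (lin t c)) y + coef (lin s (boundary c)) y = coef c y.
  rewrite !coef_ev ev_boundary !ev_lin ev_boundary.
  rewrite /ev -big_split; apply: eq_bigr => p _ /=; rewrite -mulrzDl.
  congr (_ *~ _); have := st p.2 y.
  by rewrite !coef_ev ev_boundary ev_lin ev_boundary !ev_pt.
rewrite coef_ev ev_boundary ev_cat ev_scale -!ev_boundary -!coef_ev mulrN1z.
have := st_lin (boundary (pt g)) x.
rewrite [X in _ + X](_ : _ = 0) ?addr0 => [->|]; first by rewrite subrr.
rewrite coef_ev ev_lin ev_eq0 // => y.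
by rewrite coef_boundary_boundary mulr0z.
Qed.

(** Evaluate [F] on the two sides of the contraction identity for [g]: the term [boundary (t g)]
    contributes nothing because [F] is a cocycle. The map [s] is chosen before [V] and [F]. *)
Lemma bar_cocycle_primitive n :
  exists s : ('I_n -> G) -> chain G n.+1,
  forall (V : zmodType) (F : ('I_n.+1 -> G) -> V),
    (forall g, bar_coboundary F g = 0) ->
    forall g, F g = bar_coboundary (fun y => ev F (s y)) g.
Proof.
have [s [t st]] := bar_contraction n; exists s => V F F0 g.
pose c := boundary (t g) ++ lin s (boundary (pt g)).
rewrite -(ev_pt F g) -(@ev_eq _ _ _ F c).
  rewrite ev_cat ev_boundary ev_eq0 => [|x]; last by rewrite F0 mul0rz.
  by rewrite add0r ev_lin ev_boundary ev_pt.
by move=> x; rewrite coef_cat st.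
Qed.

End Contraction.

(** * Absolute values and the non-archimedean case *)

Section AbsoluteValue.
Variables (K : fieldType) (a : K -> R).
Hypothesis aA : is_absolute_value a.

Lemma abs_ge0 x : 0 <= a x. Proof. by case: aA. Qed.

Lemma abs0 : a 0 = 0. Proof. by case: aA => _ /(_ 0)[_ ->]. Qed.

Lemma abs_eq0 x : (a x == 0) = (x == 0).
Proof. by case: aA => _ a0 _ _; apply/eqP/eqP => /a0. Qed.

Lemma abs_gt0 x : (0 < a x) = (x != 0).
Proof. by rewrite lt_def abs_eq0 abs_ge0 andbT. Qed.

Lemma absM x y : a (x * y) = a x * a y. Proof. by case: aA. Qed.

Lemma absD x y : a (x + y) <= a x + a y. Proof. by case: aA. Qed.

Lemma abs1 : a 1 = 1.
Proof.
have /mulfI : a 1 != 0 by rewrite abs_eq0 oner_eq0.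
by apply; rewrite -absM !mulr1.
Qed.

Lemma absX x n : a (x ^+ n) = a x ^+ n.
Proof. by elim: n => [|n IH]; rewrite ?expr0 ?abs1 // !exprS absM IH. Qed.

Lemma absN x : a (- x) = a x.
Proof.
have : a (- 1) ^+ 2 == 1 by rewrite -absX sqrrN expr1n abs1.
rewrite sqrf_eq1 => /orP[] /eqP e; first by rewrite -mulN1r absM e mul1r.
by have := abs_ge0 (- 1); rewrite e; lra.
Qed.

Lemma absB x y : a (x - y) <= a x + a y.
Proof. by rewrite -(absN y) absD. Qed.

Lemma abs_distC x y : a (x - y) = a (y - x).
Proof. by rewrite -absN opprB. Qed.

Lemma abs_dist x y : a x - a y <= a (x - y).
Proof. by rewrite lerBlDr -{1}(subrK y x) absD. Qed.

Lemma absV x : a x^-1 = (a x)^-1.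
Proof.
have [->|x0] := eqVneq x 0; first by rewrite invr0 abs0 invr0.
have /mulfI : a x != 0 by rewrite abs_eq0.
by apply; rewrite -absM !divff ?abs1 ?abs_eq0.
Qed.

Lemma abs_sum (I : Type) (r : seq I) (P : pred I) (F : I -> K) :
  a (\sum_(i <- r | P i) F i) <= \sum_(i <- r | P i) a (F i).
Proof.
elim/big_ind2: _ => // [|x u y v xu yv]; first by rewrite abs0.
by rewrite (le_trans (absD _ _)) ?lerD.
Qed.

Lemma abs_intr_absz (n : int) : a n%:~R = a `|n|%N%:R.
Proof. by case: n => n //; rewrite NegzE mulrNz absN abszN. Qed.

Lemma abs_nat_le (n : nat) : a n%:R <= n%:R.
Proof.
elim: n => [|n IH]; first by rewrite abs0.
by rewrite !mulrSr (le_trans (absD _ _)) // abs1 lerD2r.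
Qed.

End AbsoluteValue.

(** The end of each power trick below: an estimate valid for all powers up to a linear factor holds
    with constant [1]. *)
Lemma subexponential_le1 (b : R) (c : nat) :
  0 <= b -> (forall n : nat, b ^+ n <= n%:R + c%:R) -> b <= 1.
Proof.
move=> b0 bn; rewrite leNgt; apply/negP => b1.
(* [b ^+ 2n >= (n(b-1))^2] grows faster than [2n + c] *)
pose e := b - 1; have e0 : 0 < e by rewrite subr_gt0.
have bern n : n%:R * e <= b ^+ n.
  elim: n => [|n IH]; first by rewrite mul0r expr0.
  rewrite exprS -natr1 mulrDl mul1r.
  have : 1 <= b ^+ n by rewrite exprn_ege1 // ltW.
  move: IH; rewrite /e; nra.
(* This gives [n * e ^+ 2 > 2 + c]; the successor ensures [1 <= n], whence
   [(n * e) ^+ 2 > 2 * n + c]. *)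
pose n := (Num.bound ((2 + c%:R) / e ^+ 2)).+1.
have hn : (2 + c%:R) / e ^+ 2 < n%:R.
  apply: lt_trans (archi_boundP _) _; last by rewrite ltr_nat.
  by rewrite divr_ge0 ?addr_ge0 ?ler0n ?exprn_ge0 ?ltW.
rewrite ltr_pdivrMr ?exprn_gt0 // in hn.
have n1 : 1 <= n%:R :> R by rewrite ler1n.
have h : (n%:R * e) ^+ 2 <= (n * 2)%:R + c%:R.
  apply: le_trans (bn _); rewrite exprM ler_pXn2r // nnegrE ?exprn_ge0 //.
  by rewrite mulr_ge0 ?ltW.
rewrite natrM exprMn in h; have c0 : 0 <= c%:R :> R by rewrite ler0n.
nra.
Qed.

Section NonArchimedean.
Variables (K : fieldType) (a : K -> R).
Hypothesis aA : is_absolute_value a.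
Hypothesis nat1 : forall n : nat, a n%:R <= 1.

(** The binomial expansion of [(x + y) ^+ n] has [n + 1] terms, each at most [C ^+ n] since binomial
    coefficients have absolute value at most [1]. The power trick removes the factor [n + 1]; the
    case [C = 0] is separate because the proof divides by [C]. *)
Lemma ultrametric x y (C : R) : a x <= C -> a y <= C -> a (x + y) <= C.
Proof.
move=> xC yC; have C0 : 0 <= C := le_trans (abs_ge0 aA x) xC.
move: C0; rewrite le_eqVlt => /orP[/eqP C0|C0].
  have x0 : a x = 0 by apply: le_anti; rewrite (abs_ge0 aA) C0 xC.
  have y0 : a y = 0 by apply: le_anti; rewrite (abs_ge0 aA) C0 yC.
  by rewrite (le_trans (absD aA _ _)) // x0 y0 addr0 -C0.
rewrite -[leRHS]mul1r -ler_pdivrMr //; apply: (@subexponential_le1 _ 1).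
  by rewrite divr_ge0 ?(abs_ge0 aA) ?ltW.
move=> n; rewrite expr_div_n ler_pdivrMr ?exprn_gt0 // -(absX aA) exprDn.
rewrite (le_trans (abs_sum aA _ _ _)) // natr1 mulr_natl.
rewrite -[n.+1 in leRHS]card_ord.
rewrite -sumr_const ler_sum // => i _.
rewrite -mulr_natr !(absM aA) !(absX aA).
rewrite -[leRHS]mulr1 ler_pM ?mulr_ge0 ?exprn_ge0 ?(abs_ge0 aA) //.
have ile : (i <= n)%N by rewrite -ltnS.
rewrite -[in leRHS](subnK ile) exprD ler_pM ?exprn_ge0 ?(abs_ge0 aA) //;
  by apply: lerXn2r => //; rewrite nnegrE ?(abs_ge0 aA) // ltW.
Qed.

Lemma abs_int_le1 (n : int) : a n%:~R <= 1.
Proof. by rewrite (abs_intr_absz aA). Qed.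

Lemma ev_abs_le (G : group) n (F : ('I_n -> G) -> K) (C : R) (c : chain G n) :
  0 <= C -> (forall x, a (F x) <= C) -> a (ev F c) <= C.
Proof.
move=> C0 FC; rewrite /ev; elim/big_ind: _; first by rewrite (abs0 aA).
  by move=> x y; exact: ultrametric.
move=> p _; rewrite -mulrzr (absM aA) -[C]mulr1.
by rewrite ler_pM ?(abs_ge0 aA) ?FC ?abs_int_le1.
Qed.

Lemma nonarchimedean_boundedly_acyclic (G : group) :
  integrally_acyclic G -> boundedly_acyclic G a.
Proof.
move=> acyc m; apply/bcoh_vanishes_bar => F [C FC] F0.
have [s sP] := bar_cocycle_primitive acyc m.
exists (fun y => ev F (s y)); last exact: sP.
exists C => y; apply: ev_abs_le => //.
exact: le_trans (abs_ge0 aA _) (FC (fun=> gone G)).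
Qed.

End NonArchimedean.

(** * From bounded cohomology to integral homology *)

Section SeparatingFunctional.
Variables (K : fieldType) (V : lmodType K).

Definition submodule (W : set V) : Prop :=
  W 0 /\ forall (k : K) u v, W u -> W v -> W (k *: u + v).

(** Zorn's lemma gives a maximal subspace [W] containing [W0] and missing [c]. It is a complement of
    the line through [c], and [F] is the coefficient of [c]. *)
Lemma separating_functional (W0 : set V) (c : V) :
  submodule W0 -> ~ W0 c ->
  exists F : V -> K, [/\ forall k u v, F (k *: u + v) = k * F u + F v,
    forall v, W0 v -> F v = 0 & F c = 1].
Proof.
move=> sW0 W0c.
pose ok (W : set V) := [/\ submodule W, (W0 `<=` W)%classic & ~ W c].
(* [set0] is added because it is the union of the empty chain *)
have [|W [[W_0|[[W0W WD] sub Wc]] Wmax]] :=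
    @Zorn_bigcup V [set W | W = set0 \/ ok W]%classic.
- move=> F Fok Ftot.
  have [[W FW okW]|none] := pselect (exists2 W, F W & ok W); last first.
    left; apply/seteqP; split=> // v [W FW Wv].
    case: (Fok _ FW) => [W_0|okW]; first by rewrite W_0 in Wv.
    by case: none; exists W.
  right; split.
  + split; first by exists W => //; case: okW => -[].
    move=> k u v [A FA Au] [B FB Bv].
    have mem C x : F C -> C x -> ok C.
      by move=> FC Cx; case: (Fok _ FC) => // C0; rewrite C0 in Cx.
    have [AB|BA] := Ftot _ _ FA FB.
      exists B => //; case: (mem _ _ FB Bv) => -[_ +] _ _.
      by apply; first exact: AB.
    exists A => //; case: (mem _ _ FA Au) => -[_ +] _ _.
    by apply => //; exact: BA.
  + by move=> v Wv; exists W => //; case: okW => _ + _; apply.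
  + move=> [A FA Ac]; case: (Fok _ FA) => [A0|[_ _]]; last exact.
    by rewrite A0 in Ac.
- case: (Wmax W0); last by right; split.
  by rewrite W_0; split=> // /(_ 0); apply; case: sW0.
(* If [v] is not in [W], the span [W'] of [W] and [v] must contain [c] by maximality, and that
   relation is solved for [v]. *)
have proj v : exists k, W (v - k *: c).
  have [Wv|nWv] := pselect (W v); first by exists 0; rewrite scale0r subr0.
  pose W' : set V := [set u | exists k, W (u - k *: v)]%classic.
  have WW' : (W `<=` W')%classic.
    by move=> u Wu; exists 0; rewrite scale0r subr0.
  have W'v : W' v by exists 1; rewrite scale1r subrr.
  have [[k Wk]|nW'c] := pselect (W' c).
    have k0 : k != 0.
      by apply: contra_notN Wc => /eqP k0; rewrite k0 scale0r subr0 in Wk.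
    exists k^-1; have := WD (- k^-1) _ _ Wk W0W.
    rewrite addr0 scalerBr scalerA mulNr mulVf // !scaleNr scale1r opprK.
    by rewrite addrC.
  case: (Wmax W').
    by split=> // /(_ v W'v).
  right; split=> //; last by move=> u /sub /WW'.
  split; first exact: WW'.
  move=> k u w [k1 W1] [k2 W2]; exists (k * k1 + k2).
  by rewrite scalerDl opprD addrACA -scalerA -scalerBr; apply: WD.
have [F FW] := choice proj.
have uniq v k : W (v - k *: c) -> F v = k.
  move=> Wk; apply: contrapT => /eqP neq.
  have := WD (- 1) _ _ (FW v) Wk.
  rewrite scaleN1r opprB addrA subrK -scalerBl => Wd.
  apply: Wc; have := WD (F v - k)^-1 _ _ Wd W0W.
  by rewrite addr0 scalerA mulVf ?scale1r // subr_eq0.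
exists F; split.
- move=> k u v; apply: uniq.
  by rewrite scalerDl opprD addrACA -scalerA -scalerBr; apply: WD.
- by move=> v /sub Wv; apply: uniq; rewrite scale0r subr0.
- by apply: uniq; rewrite scale1r subrr.
Qed.

End SeparatingFunctional.

Definition trivial_abs (K : fieldType) (x : K) : R := if x == 0 then 0 else 1.

Lemma trivial_abs_le1 (K : fieldType) (x : K) : trivial_abs x <= 1.
Proof. by rewrite /trivial_abs; case: ifP. Qed.

Lemma trivial_abs_absolute_value (K : fieldType) :
  is_absolute_value (@trivial_abs K).
Proof.
rewrite /trivial_abs; split=> [x|x|x y|x y].
- by case: ifP.
- by case: eqP => [->|x0]; split=> // /eqP; rewrite oner_eq0.
- by rewrite mulf_eq0; case: eqP => _; case: eqP => _ /=;
    rewrite ?mul0r ?mulr0 ?mulr1.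
- have [->|x0] := eqVneq x 0; first by rewrite !add0r.
  by case: (y == 0); case: ifP => _; rewrite ?addr0 ?lerDl ?addr_ge0.
Qed.

(** A Cauchy sequence is constant once its distances drop below [1]. *)
Lemma trivial_abs_complete (K : fieldType) : abs_complete (@trivial_abs K).
Proof.
move=> u /(_ 1 ltr01)[N uN]; exists (u N) => e e0; exists N => n Nn.
have := uN n N Nn (leqnn N); rewrite /trivial_abs.
by case: ifP => //; rewrite ltxx.
Qed.

Section PrimeField.
Variables (G : group) (K : fieldType).
Hypothesis primeK :
  forall k : K, exists p q : int, q%:~R != 0 :> K /\ k = p%:~R / q%:~R.
Hypothesis acyc : boundedly_acyclic G (@trivial_abs K).

(** A functional separating [c] from the boundaries over [K] would restrict to a bar cocycle,
    bounded by [1], hence to a coboundary, and so vanish on the cycle [c]. As the elements of [K]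
    are quotients of integers, denominators can be cleared: [e] is integral and [l] is invertible in
    [K]. *)
Lemma prime_field_exact m (c : chain G m.+1) :
  (forall x, (coef (boundary c) x)%:~R = 0 :> K) ->
  exists (l : int) (e : chain G m.+2), l%:~R != 0 :> K /\
    forall x, (l * coef c x)%:~R = (coef (boundary e) x)%:~R :> K.
Proof.
move=> cyc.
pose V : lmodType K := (('I_m.+1 -> G) -> K^o).
pose io (d : chain G m.+1) : V := fun x => (coef d x)%:~R.
(* The [K]-span of the boundaries, written with cleared denominators. *)
pose W0 : set V :=
  [set v | exists (l : int) (e : chain G m.+2),
     l%:~R != 0 :> K /\ forall x, l%:~R * v x = io (boundary e) x]%classic.
have sW0 : submodule W0.
  split; first by exists 1, [::]; rewrite oner_neq0; split=> // x;
    rewrite mulr0 /io /coef big_nil.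
  move=> k u v [l1 [e1 [l10 h1]]] [l2 [e2 [l20 h2]]].
  have [p [q [q0 ->]]] := primeK k.
  exists (q * l1 * l2), (scale (p * l2) e1 ++ scale (q * l1) e2); split.
    by rewrite !intrM !mulf_neq0.
  move=> x; have := h1 x; have := h2 x; rewrite /io.
  rewrite coef_boundary_cat !coef_boundary_scale.
  move=> E2 E1; rewrite rmorphD /= !intrM -E1 -E2.
  have -> : (p%:~R / q%:~R *: u + v) x = p%:~R / q%:~R * (u x : K) + v x by [].
  by move: (u x : K) (v x : K) => s t; field.
have [[l [e [l0 le]]]|nW0] := pselect (W0 (io c)).
  by exists l, e; split=> // x; rewrite intrM; exact: le.
have [F [Flin FW0 Fc]] := separating_functional sW0 nW0.
have F0 : F 0 = 0 by apply: FW0; case: sW0.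
pose f (g : 'I_m.+1 -> G) : K := F (io (pt g)).
have Fio d : F (io d) = ev f d.
  elim: d => [|p d IH].
    rewrite /ev big_nil -F0; congr F; apply: funext => x.
    by rewrite /io /coef big_nil.
  rewrite /ev big_cons -/(ev f d) -IH.
  have -> : io (p :: d) = p.1%:~R *: io (pt p.2) + io d.
    apply: funext => x;
    have -> : (p.1%:~R *: io (pt p.2) + io d) x =
        p.1%:~R * (coef (pt p.2) x)%:~R + (coef d x)%:~R :> K by [].
    rewrite -intrM -coef_scale -intrD -coef_cat /scale /= mulr1.
    by case: (p).
  by rewrite Flin mulrzl.
have /bcoh_vanishes_bar/(_ f)[||H _ fH] := @acyc m.
- by exists 1 => g; exact: trivial_abs_le1.
- move=> g; rewrite -(ev_pt (bar_coboundary f) g) -ev_boundary -Fio FW0 //.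
  by exists 1, (pt g); rewrite oner_neq0; split=> // x; rewrite mul1r.
exfalso; move: Fc; rewrite Fio.
have -> : f = bar_coboundary H by apply: funext.
rewrite -ev_boundary ev_eq0 => [|x]; last by rewrite -mulrzr cyc mulr0.
by move/eqP; rewrite eq_sym oner_eq0.
Qed.

End PrimeField.

Lemma universally_acyclic_integrally (G : group) :
  universally_boundedly_acyclic G -> integrally_acyclic G.
Proof.
move=> univ m c cyc.
have triv K : boundedly_acyclic G (@trivial_abs K).
  apply: univ; first exact: trivial_abs_absolute_value.
  exact: trivial_abs_complete.
have primeQ (k : rat) :
    exists p q : int, q%:~R != 0 :> rat /\ k = p%:~R / q%:~R.
  exists (numq k), (denq k); rewrite divq_num_den; split=> //.
  by rewrite intr_eq0 denq_neq0.
have [l [e []]] :=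
  prime_field_exact primeQ (triv _) (fun x => congr1 _ (cyc x)).
rewrite intr_eq0 => l0 le.
(* The sign of [l] moves into the chain, so that the multiple is a positive natural number. *)
have {l0 le} [N] : exists N : nat, exists2 b : chain G m.+2, (0 < N)%N &
    forall x, coef (boundary b) x = N%:Z * coef c x.
  exists `|l|%N; exists (scale (sgz l) e); first by rewrite absz_gt0.
  move=> x; rewrite coef_boundary_scale.
  have /eqP := le x; rewrite eqr_int => /eqP <-.
  by rewrite mulrA -abszEsg.
(* Strong induction on [N], dividing out one prime factor [p] each time until [N = 1]. *)
have [n] := ubnP N; elim: n N => // n IH N Nn [b N0 bN].
have [N1|N1] := leqP N 1.
  exists b => x; rewrite bN (_ : N = 1)%N ?mul1r //.
  by apply/eqP; rewrite eqn_leq N1.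
have pp := pdiv_prime N1; set p := pdiv N in pp.
have pK := pchar_Fp pp.
have primeFp (k : 'F_p) :
    exists s q : int, q%:~R != 0 :> 'F_p /\ k = s%:~R / q%:~R.
  exists (nat_of_ord k), 1; rewrite oner_neq0 divr1; split=> //.
  by rewrite -[LHS]natr_Zp.
have pNd : N = (p * (N %/ p))%N by rewrite mulnC divnK // pdiv_dvd.
have bcyc x : (coef (boundary b) x)%:~R = 0 :> 'F_p.
  by rewrite bN pNd PoszM !intrM -pmulrn (pcharf0 pK) !mul0r.
have [l' [d [l'0 dl']]] := prime_field_exact primeFp (triv _) bcyc.
(* [l'] is invertible modulo [p], so [b] is a boundary modulo [p] *)
have cop : coprimez l' p.
  rewrite coprimezE /= coprime_sym prime_coprime //; apply: contraNN l'0 => pl.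
  by rewrite -(dvdz_pcharf pK) dvdzE.
have /coprimezP[[u v] /= uv] := cop.
(* Since [u * l' + v * p = 1], the coefficients of [z] are divisible by [p]. Its boundary is still
   [N] times [c], so the quotient [y] has boundary [N %/ p] times [c]. *)
pose z := b ++ scale (- u) (boundary d).
have /choice[q zq] x : exists t, coef z x = p%:Z * t.
  suff /dvdzP[t ->] : (p %| coef z x)%Z by exists t; rewrite mulrC.
  rewrite (dvdz_pcharf pK) coef_cat coef_scale rmorphD /= intrM -dl'.
  rewrite -intrM -rmorphD /= -(dvdz_pcharf pK); apply/dvdzP.
  exists (v * coef b x); have := congr1 (fun t => t * coef b x) uv; lia.
have [y zy] := chain_divide zq.
apply: (IH (N %/ p)%N).
  by apply: leq_trans (ltn_Pdiv (prime_gt1 pp) N0) _; rewrite -ltnS.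
exists y; first by rewrite divn_gt0 ?prime_gt0 // dvdn_leq // pdiv_dvd.
move=> x; apply: (@mulfI _ p%:Z); first by rewrite eqz_nat -lt0n prime_gt0.
rewrite mulrA -PoszM -pNd -bN -coef_boundary_scale.
rewrite !coef_ev !ev_boundary (@ev_eq _ _ _ _ (scale _ _) z); last first.
  by move=> w; rewrite coef_scale zy.
rewrite -ev_boundary -coef_ev coef_boundary_cat coef_boundary_scale.
by rewrite coef_boundary_boundary mulr0 addr0 coef_ev ev_boundary.
Qed.

(** * Archimedean fields *)

Section PlaneMinimum.
Variable R : realType.
Variable f : R -> R -> R.
Hypothesis f_cont : forall u0 v0 e, 0 < e -> exists2 d, 0 < d &
  forall u v, `|u - u0| < d -> `|v - v0| < d -> `|f u v - f u0 v0| < e.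
Hypothesis f_proper : forall M, exists T, forall u v, f u v <= M ->
  `|u| <= T /\ `|v| <= T.

(** The sublevel set of [f 0 0] lies in a compact square containing the origin; a minimum over the
    square is global because [f] exceeds [f 0 0] outside it. *)
Lemma plane_min : exists u0 v0, forall u v, f u0 v0 <= f u v.
Proof.
have [T fT] := f_proper (f 0 0).
have [T0 _] := fT 0 0 (lexx _); rewrite normr0 in T0.
pose A : set (R * R) := (`[- T, T] `*` `[- T, T])%classic.
have cA : compact A by apply: compact_setX; exact: segment_compact.
have inA u v : `|u| <= T -> `|v| <= T -> A (u, v).
  by move=> uT vT; split; rewrite /= in_itv /= -ler_norml.
have A0 : (A !=set0)%classic by exists (0, 0); apply: inA; rewrite normr0.
have fc : ({within A, continuous (fun z => f z.1 z.2)})%classic.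
  apply: continuous_subspaceT => -[u0 v0].
  apply/cvgrPdist_lt => e e0; have [d d0 fd] := f_cont u0 v0 e0.
  exists (ball u0 d, ball v0 d); first by split; exact: nbhsx_ballx.
  move=> [u v] [/= ud vd]; rewrite distrC; apply: fd; rewrite distrC.
    exact: ud.
  exact: vd.
have [[u0 v0] _ fmin] := compact_EVT_min A0 cA fc.
exists u0, v0 => u v.
have [fuv|fuv] := lerP (f u v) (f 0 0).
  have [uT vT] := fT _ _ fuv.
  by apply: (fmin (u, v)); apply/mem_set/inA.
apply: le_trans (ltW fuv); apply: (fmin (0, 0)); apply/mem_set.
by apply: inA; rewrite normr0.
Qed.

End PlaneMinimum.

Section RealFactorization.
Import complex.
Variable R : rcfType.
Local Notation toC := (real_complex R).

(** The monic real quadratic with roots [u + i v] and [u - i v]. *)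
Definition quad_poly (u v : R) : {poly R} :=
  ('X - u%:P) ^+ 2 + (v ^+ 2)%:P.

(** Over the complex numbers [p] splits and equals its own conjugate. Multiplying the two
    factorizations matches each root with its conjugate, so squaring avoids sorting the roots of [p]
    into pairs. *)
Lemma monic_sqr_quad (p : {poly R}) : p \is monic ->
  exists2 s : seq (R * R), size s = (size p).-1 &
    p ^+ 2 = \prod_(z <- s) quad_poly z.1 z.2.
Proof.
move=> pm.
have [r] := closed_field_poly_normal (map_poly toC p).
rewrite (monicP _) ?monic_map // scale1r => pr.
exists [seq (Re z, Im z) | z <- r].
  by rewrite size_map -(size_map_poly toC) pr size_prod_XsubC.
have prc : map_poly toC p = \prod_(z <- r) ('X - (conjc z)%:P).
  have -> : map_poly toC p = map_poly conjc (map_poly toC p).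
    rewrite -map_poly_comp; apply: eq_map_poly => t /=.
    exact/esym/conjc_real.
  rewrite pr rmorph_prod; apply: eq_bigr => z _.
  by rewrite rmorphB /= map_polyX map_polyC.
apply: (map_poly_inj toC).
rewrite rmorphXn expr2 /= {1}pr prc -big_split rmorph_prod big_map /=.
apply: eq_bigr => -[u v] _.
rewrite /quad_poly rmorphD rmorphXn rmorphB /= map_polyX !map_polyC /=.
have -> : Complex u v = toC u + Complex 0 v.
  by apply/eqP; rewrite eq_complex /= addr0 add0r !eqxx.
have -> : Complex u (- v) = toC u - Complex 0 v.
  by apply/eqP; rewrite eq_complex /= subr0 sub0r !eqxx.
have -> : toC (v ^+ 2) = - (Complex 0 v) ^+ 2.
  by rewrite expr2; apply/eqP; rewrite eq_complex; apply/andP; split;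
    apply/eqP => /=; ring.
rewrite polyCD polyCB polyCN polyC_exp; ring.
Qed.

End RealFactorization.

Lemma geometric_unbounded (b C : R) : 1 < b -> exists k : nat, C < b ^+ k.
Proof.
move=> b1; apply: contrapT => no.
have : b <= 1; last by rewrite leNgt b1.
apply: (@subexponential_le1 _ (Num.bound `|C|)).
  by rewrite (le_trans ler01) ?ltW.
move=> n; apply: (@le_trans _ _ C).
  by rewrite leNgt; apply/negP => Cb; apply: no; exists n.
apply: le_trans (ler_norm _) _.
apply: (le_trans (ltW (archi_boundP (normr_ge0 C)))).
by rewrite lerDr.
Qed.

(** * Embedding the reals by expansions in base [m] *)

Section RealEmbedding.
Variables (K : fieldType) (a : K -> R).
Hypothesis aA : is_absolute_value a.
Hypothesis a_complete : abs_complete a.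
Variable m : nat.
Hypothesis am : 1 < a m%:R.

Local Notation M := (m%:R : R).
Local Notation b := (a m%:R).

Let b0 : 0 < b. Proof. exact: lt_trans ltr01 am. Qed.
Let bn0 k : 0 < b ^+ k. Proof. exact: exprn_gt0. Qed.

Let m1 : (1 < m)%N.
Proof.
case: m am => [|[|//]]; first by rewrite (abs0 aA) ltr10.
by rewrite (abs1 aA) ltxx.
Qed.

Let mK0 : m%:R != 0 :> K. Proof. by rewrite -(abs_gt0 aA). Qed.

(** Digits have absolute value at most [M], and [B * (b ^+ j - 1)] is the sum of [M * b ^+ i] over
    [i < j]. *)
Let B : R := M / (b - 1).
Let B0 : 0 <= B. Proof. by rewrite divr_ge0 // subr_ge0 ltW. Qed.

(* Expand [e] in base [m] and sum the geometric series. *)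
Lemma abs_nat_base (j e : nat) : (e < m ^ j)%N -> a e%:R <= B * (b ^+ j - 1).
Proof.
elim: j e => [|j IH] e.
  by rewrite expn0 ltnS leqn0 => /eqP ->; rewrite (abs0 aA) expr0 subrr mulr0.
move=> ej; have m0 : (0 < m)%N by lia.
have qj : (e %/ m < m ^ j)%N by rewrite ltn_divLR // mulnC -expnS.
rewrite {1}(divn_eq e m) natrD natrM (le_trans (absD aA _ _)) // (absM aA).
have rM : a (e %% m)%:R <= M.
  by rewrite (le_trans (abs_nat_le aA _)) // ler_nat ltnW // ltn_pmod.
have BM : B * (b - 1) = M by rewrite divfK // subr_eq0 gt_eqF.
have := ler_wpM2r (ltW b0) (IH _ qj).
move: rM; rewrite exprS -BM; set X := a _; set Y := a (e %/ m)%:R; nra.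
Qed.

Lemma abs_int_base (j : nat) (e : int) :
  `|e%:~R| < M ^+ j -> a e%:~R <= B * b ^+ j.
Proof.
rewrite (abs_intr_absz aA) -intr_norm -abszE -pmulrn -natrX ltr_nat => ej.
by rewrite (le_trans (abs_nat_base ej)) // mulrBr lerBlDr lerDl mulr1.
Qed.

(** The base [m] expansion of [t], cut after [k] fractional digits and read in [K]. *)
Definition digits (t : R) (k : nat) : K :=
  (Num.floor (t * M ^+ k))%:~R / m%:R ^+ k.

Lemma abs_div_m x k : a (x / m%:R ^+ k) = a x / b ^+ k.
Proof. by rewrite (absM aA) (absV aA) (absX aA). Qed.

(** The difference is [d / m ^+ (k + j)] for an integer [d] with [0 <= d < m ^+ j], which has at
    most [j] digits. *)
Lemma digits_cauchy t k j : a (digits t (k + j) - digits t k) <= B / b ^+ k.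
Proof.
pose d : int :=
  Num.floor (t * M ^+ (k + j)) - Num.floor (t * M ^+ k) * m%:Z ^+ j.
have -> : digits t (k + j) - digits t k = d%:~R / m%:R ^+ (k + j).
  rewrite /digits /d rmorphB rmorphM /= rmorphXn /= -pmulrn !exprD.
  by field; rewrite !expf_neq0.
have [M0 Mj Mk] : [/\ 0 < M, 0 < M ^+ j & 0 < M ^+ k].
  by split; rewrite ?exprn_gt0 // ltr0n; lia.
have dR : d%:~R = (Num.floor (t * M ^+ (k + j)))%:~R
    - (Num.floor (t * M ^+ k))%:~R * M ^+ j :> R.
  by rewrite /d rmorphB rmorphM /= rmorphXn /= -pmulrn.
rewrite abs_div_m exprD ler_pdivrMr ?mulr_gt0 //.
have -> : B / b ^+ k * (b ^+ k * b ^+ j) = B * b ^+ j.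
  by field; rewrite gt_eqF.
apply: abs_int_base.
have /andP[l1 l2] := floor_itv (t * M ^+ (k + j)).
have /andP[l3 l4] := floor_itv (t * M ^+ k).
rewrite intrD in l2; rewrite intrD in l4; rewrite exprD mulrA in l1 l2.
have l5 := ler_wpM2r (ltW Mj) l3; have l6 : t * M ^+ k * M ^+ j
   < ((Num.floor (t * M ^+ k))%:~R + 1) * M ^+ j by rewrite ltr_pM2r.
have d0 : 0 <= d.
  by rewrite -ltzD1 -(ltr_int R) intrD dR exprD mulrA; lra.
rewrite ger0_norm ?ler0z // dR exprD mulrA; lra.
Qed.

Lemma digits_cvg t : exists x, forall k, a (digits t k - x) <= B / b ^+ k.
Proof.
have small e : 0 < e -> exists N : nat, B / b ^+ N < e.
  move=> e0; have [N hN] := geometric_unbounded (B / e) am.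
  by exists N; rewrite ltr_pdivrMr // mulrC -ltr_pdivrMr.
have [|x xP] := a_complete (u := digits t).
  move=> e e0; have [N hN] := small (e / 2) (divr_gt0 e0 (ltr0Sn _ 1)).
  exists N => p q Np Nq.
  have := absB aA (digits t p - digits t N) (digits t q - digits t N).
  rewrite opprB addrA subrK; move/le_lt_trans; apply.
  rewrite -(subnKC Np) -(subnKC Nq).
  by have := digits_cauchy t N (p - N); have := digits_cauchy t N (q - N); lra.
exists x => k; apply/ler_addgt0Pr => e e0; have [N hN] := xP e e0.
have := absD aA (digits t k - digits t (k + N)) (digits t (k + N) - x).
rewrite addrA subrK => /le_trans; apply.
rewrite (abs_distC aA) lerD ?digits_cauchy // ltW // hN //; lia.
Qed.

(** Applied below to the defects of additivity, of the unit and of multiplicativity of the limit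
    map. *)
Lemma abs_vanish z C : (forall k, a z <= C / b ^+ k) -> z = 0.
Proof.
move=> zC; apply/eqP; rewrite -(abs_eq0 aA); apply: contraT => z0.
have za : 0 < a z by rewrite lt_def z0 (abs_ge0 aA).
have [k hk] := geometric_unbounded (C / a z) am.
by move: hk (zC k); rewrite ltr_pdivrMr // ler_pdivlMr // mulrC => /lt_geF ->.
Qed.

Lemma real_embedding : exists (phi : {rmorphism R -> K}) (D : R),
  forall t, `|t| <= 1 -> a (phi t) <= D.
Proof.
have [phi phiP] := choice digits_cvg.
(* Any integer within [n] of [t * M ^+ k] approximates as well as the floor, from which it differs
   by at most [n + 1]. *)
have near t k (e : int) (n : nat) : `|t * M ^+ k - e%:~R| <= n%:R ->
    a (e%:~R / m%:R ^+ k - phi t) <= (B + n%:R + 1) / b ^+ k.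
  move=> te.
  have := absD aA (e%:~R / m%:R ^+ k - digits t k) (digits t k - phi t).
  rewrite addrA subrK => /le_trans; apply.
  rewrite -addrA addrC mulrDl lerD //.
  rewrite /digits -mulrBl -rmorphB /= abs_div_m ler_pM2r ?invr_gt0 //.
  rewrite (abs_intr_absz aA) (le_trans (abs_nat_le aA _)) //.
  rewrite pmulrn abszE intr_norm rmorphB /=.
  have /andP[l1 l2] := floor_itv (t * M ^+ k); rewrite intrD in l2.
  move: te; rewrite !ler_norml; lra.
have phiD : {morph phi : t u / t + u}.
  move=> t u; apply/eqP; rewrite eq_sym -subr_eq0; apply/eqP.
  apply: (@abs_vanish _ (B + 2%:R + 1 + 2%:R * B)) => k.
  have h : a (digits t k + digits u k - phi (t + u))
      <= (B + 2%:R + 1) / b ^+ k.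
    rewrite /digits -mulrDl -intrD; apply: near; rewrite intrD.
    have /andP[l1 l2] := floor_itv (t * M ^+ k); rewrite intrD in l2.
    have /andP[l3 l4] := floor_itv (u * M ^+ k); rewrite intrD in l4.
    by rewrite ler_norml; lra.
  have -> : phi t + phi u - phi (t + u) =
     (digits t k + digits u k - phi (t + u))
     - ((digits t k - phi t) + (digits u k - phi u)) by ring.
  rewrite (le_trans (absB aA _ _)) // [leRHS]mulrDl lerD //.
  rewrite (le_trans (absD aA _ _)) //.
  by have := phiP t k; have := phiP u k; lra.
have phiB : {morph phi : t u / t - u}.
  by move=> t u; apply/eqP; rewrite eq_sym subr_eq -phiD subrK.
pose phiA := HB.pack_for {additive R -> K} phi
  (GRing.isZmodMorphism.Build R K phi phiB).
have phi1 : phi 1 = 1.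
  apply/eqP; rewrite eq_sym -subr_eq0; apply/eqP.
  apply: (@abs_vanish _ (B + 0%:R + 1)) => k.
  have := near 1 k (m%:Z ^+ k) 0%N.
  rewrite !rmorphXn /= -!pmulrn divff ?expf_neq0 // mul1r subrr normr0.
  exact.
have phiMz t z : phi (t * z%:~R) = phi t * z%:~R.
  by rewrite !mulrzr; exact: (raddfMz phiA).
have phiz z : phi z%:~R = z%:~R by rewrite -[z%:~R]mul1r phiMz phi1 mul1r.
have phiMm t k : phi (t * M ^+ k) = phi t * m%:R ^+ k.
  by have := phiMz t (m%:Z ^+ k); rewrite !rmorphXn /= -!pmulrn.
pose D := B + 1%:R + 1.
have phi_bound t : `|t| <= 1 -> a (phi t) <= D.
  move=> t1; have := near t 0%N 0 1%N.
  rewrite !expr0 mulr1 subr0 mul0r sub0r (absN aA) divr1; exact.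
(* Write [t * M ^+ k = q + r] with [q] an integer and [r] in the unit interval. Additivity handles
   [q], so the defect times [m ^+ k] is [phi (r * u) - phi r * phi u], bounded independently of
   [k]. *)
have phiM1 t u : `|u| <= 1 -> phi (t * u) = phi t * phi u.
  move=> u1; apply/eqP; rewrite -subr_eq0; apply/eqP.
  apply: (@abs_vanish _ (D + D * D)) => k.
  pose q := Num.floor (t * M ^+ k); pose r := t * M ^+ k - q%:~R.
  have r1 : `|r| <= 1.
    have /andP[l1 l2] := floor_itv (t * M ^+ k); rewrite intrD in l2.
    by rewrite ler_norml /r /q; lra.
  have tE : t * M ^+ k = q%:~R + r by rewrite /r addrC subrK.
  have e1 : phi t * m%:R ^+ k = q%:~R + phi r by rewrite -phiMm tE phiD phiz.
  have e2 : phi (t * u) * m%:R ^+ k = q%:~R * phi u + phi (r * u).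
    rewrite -phiMm mulrAC tE mulrDl phiD.
    by rewrite mulrC phiMz mulrC.
  rewrite ler_pdivlMr // -(absX aA) -(absM aA) mulrBl e2 mulrAC e1.
  have -> : q%:~R * phi u + phi (r * u) - (q%:~R + phi r) * phi u
    = phi (r * u) - phi r * phi u by ring.
  rewrite (le_trans (absB aA _ _)) // (absM aA) lerD //.
    by apply: phi_bound; rewrite normrM -[1]mulr1 ler_pM.
  by rewrite ler_pM ?(abs_ge0 aA) ?phi_bound.
have phiM : {morph phi : t u / t * u}.
  move=> t u; have M1 : 1 < M by rewrite ltr1n.
  have [k uk] := geometric_unbounded `|u| M1.
  have Mk : 0 < M ^+ k by rewrite exprn_gt0 // (lt_trans ltr01).
  have -> : u = u / M ^+ k * M ^+ k by rewrite divfK // gt_eqF.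
  rewrite mulrA !phiMm phiM1 ?mulrA // normrM normfV (gtr0_norm Mk).
  by rewrite ler_pdivrMr // mul1r ltW.
pose phiR := HB.pack_for {rmorphism R -> K} phi
  (GRing.isZmodMorphism.Build R K phi phiB)
  (GRing.isMonoidMorphism.Build R K phi (phi1, phiM)).
by exists phiR, D.
Qed.

End RealEmbedding.

Lemma sqr_max_norm_le (u v : R) : Num.max `|u| `|v| ^+ 2 <= u ^+ 2 + v ^+ 2.
Proof.
case: (leP `|u| `|v|) => _; rewrite real_normK ?num_real //.
  by rewrite lerDr sqr_ge0.
by rewrite lerDl sqr_ge0.
Qed.

(** * The Gelfand-Mazur argument with real quadratics *)

Section GelfandMazur.
Variables (K : fieldType) (a : K -> R).
Hypothesis aA : is_absolute_value a.
Variable phi : {rmorphism R -> K}.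
Variable D : R.
Hypothesis phiD : forall t, `|t| <= 1 -> a (phi t) <= D.
Variable m : nat.
Hypothesis am : 1 < a m%:R.

Local Notation alpha t := (a (phi t)).

Let alpha_ge0 t : 0 <= alpha t. Proof. exact: abs_ge0. Qed.

(* Apply the bound [D] to all powers of [t]. *)
Lemma alpha_le1 t : `|t| <= 1 -> alpha t <= 1.
Proof.
move=> t1; apply: (@subexponential_le1 _ (Num.bound `|D|)) => // n.
rewrite -(absX aA) -rmorphXn /=.
apply: (@le_trans _ _ D); first by rewrite phiD // normrX exprn_ile1.
apply: le_trans (ler_norm _) _.
apply: (le_trans (ltW (archi_boundP (normr_ge0 D)))).
by rewrite lerDr.
Qed.

Lemma alpha_mono t u : `|t| <= `|u| -> alpha t <= alpha u.
Proof.
have [->|u0] := eqVneq u 0; first by rewrite normr0 normr_le0 => /eqP ->.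
move=> tu; rewrite -(divfK u0 t) rmorphM (absM aA) ler_piMl //.
by rewrite alpha_le1 // normrM normfV ler_pdivrMr ?normr_gt0 // mul1r.
Qed.

Lemma alpha_nat (n : nat) : alpha n%:R = a n%:R.
Proof. by rewrite rmorph_nat. Qed.

(** By monotonicity it is enough to test inverse powers of [m], where [alpha] is an inverse power of
    [a m%:R]. *)
Lemma alpha_small e : 0 < e ->
  exists2 d, 0 < d & forall t, `|t| <= d -> alpha t < e.
Proof.
move=> e0; have [k hk] := geometric_unbounded e^-1 am.
have m0 : (0 < m)%N.
  by rewrite lt0n; apply: contraTneq am => ->; rewrite (abs0 aA) ltr10.
have mk : 0 < (m ^ k)%:R^-1 :> R by rewrite invr_gt0 ltr0n expn_gt0 m0.
exists (m ^ k)%:R^-1 => // t td.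
apply: (@le_lt_trans _ _ (alpha (m ^ k)%:R^-1)).
  by apply: alpha_mono; rewrite (gtr0_norm mk).
rewrite fmorphV (absV aA) alpha_nat natrX (absX aA).
have bk : 0 < a m%:R ^+ k by rewrite exprn_gt0 // (lt_trans ltr01 am).
by rewrite -[e]invrK ltf_pV2 ?posrE ?invr_gt0.
Qed.

Lemma alpha_large C : exists T, forall t, alpha t <= C -> `|t| <= T.
Proof.
have [k hk] := geometric_unbounded C am.
exists (m ^ k)%:R => t tC; rewrite leNgt; apply/negP => tT.
have : alpha (m ^ k)%:R <= alpha t by apply: alpha_mono; rewrite normr_nat ltW.
by rewrite alpha_nat natrX (absX aA) => /(lt_le_trans hk); rewrite ltNge tC.
Qed.

Section Quadratics.
Variable x : K.

(** The product of [x - z] and [x - conj z] for [z = u + i v], written without [i], which [K] may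
    lack at this point. *)
Definition quad (u v : R) : K := (x - phi u) ^+ 2 + phi v ^+ 2.

Lemma horner_quad_poly u v : (map_poly phi (quad_poly u v)).[x] = quad u v.
Proof.
rewrite /quad_poly rmorphD rmorphXn rmorphB /= map_polyX !map_polyC /=.
by rewrite !hornerE rmorphXn.
Qed.

Lemma quad_continuous u0 v0 e : 0 < e -> exists2 d, 0 < d &
  forall u v, `|u - u0| < d -> `|v - v0| < d ->
    `|a (quad u v) - a (quad u0 v0)| < e.
Proof.
(* [C] is the sum of the bounds [H1] and [H2] on the cofactors of the increments [h] and [k], which
   are kept below [1] and [e / C]. *)
move=> e0; pose C := 2%:R * a x + 2%:R * alpha u0 + 2%:R * alpha v0 + 2%:R.
have C0 : 0 < C.
  by rewrite /C; have := abs_ge0 aA x; have := alpha_ge0 u0;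
    have := alpha_ge0 v0; lra.
have eC : 0 < Num.min 1 (e / C) by rewrite lt_min ltr01 divr_gt0.
have [d d0 dP] := alpha_small eC.
exists d => // u v ud vd.
have /dP := ltW ud; have /dP := ltW vd; rewrite !lt_min !rmorphB.
set h := phi u - _; set k := phi v - _ => /andP[k1 ke] /andP[h1 he].
apply: (@le_lt_trans _ _ (a (quad u v - quad u0 v0))).
  rewrite ler_norml (abs_dist aA) andbT (abs_distC aA).
  by have := abs_dist aA (quad u0 v0) (quad u v); lra.
have -> : quad u v - quad u0 v0 =
    h * (h - (x - phi u0) *+ 2) + k * (k + phi v0 *+ 2).
  by rewrite /quad /h /k; ring.
apply: (le_lt_trans (absD aA _ _)); rewrite !(absM aA).
have n2 (y : K) : a (y *+ 2) <= 2%:R * a y.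
  by rewrite mulr2n (le_trans (absD aA _ _)) // mulr_natl mulr2n.
have H1 : a (h - (x - phi u0) *+ 2) <= 1 + 2%:R * a x + 2%:R * alpha u0.
  have := absB aA h ((x - phi u0) *+ 2); have := n2 (x - phi u0).
  by have := absB aA x (phi u0); move: h1; lra.
have H2 : a (k + phi v0 *+ 2) <= 1 + 2%:R * alpha v0.
  by have := absD aA k (phi v0 *+ 2); have := n2 (phi v0); move: k1; lra.
have ax := abs_ge0 aA x; have au := alpha_ge0 u0; have av := alpha_ge0 v0.
apply: (@lt_le_trans _ _ (e / C * (1 + 2%:R * a x + 2%:R * alpha u0)
   + e / C * (1 + 2%:R * alpha v0))); last first.
  rewrite -mulrDr mulrAC ler_pdivrMr // ler_pM2l // /C; lra.
apply: ltr_leD.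
  apply: (@le_lt_trans _ _ (a h * (1 + 2%:R * a x + 2%:R * alpha u0))).
    by rewrite ler_wpM2l ?(abs_ge0 aA).
  by rewrite ltr_pM2r //; lra.
by rewrite ler_pM ?(abs_ge0 aA) // ltW.
Qed.

(** Let [A] be [alpha] of the larger coordinate. As [u ^+ 2 + v ^+ 2] maps to [quad u v] plus
    [2 u x - x ^+ 2], the square of [A] is at most linear in [A]; dividing by [A] when [A > 1]
    bounds it. *)
Lemma quad_proper C : exists T, forall u v, a (quad u v) <= C ->
  `|u| <= T /\ `|v| <= T.
Proof.
have [T hT] := alpha_large (`|C| + a x ^+ 2 + alpha 2%:R * a x + 1).
exists T => u v quC; pose s := Num.max `|u| `|v|.
suff sT : `|s| <= T.
  have s0 : 0 <= s by rewrite le_max normr_ge0.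
  by move: sT; rewrite ger0_norm // ge_max => /andP[].
have us : `|u| <= s by rewrite le_max lexx.
have s0 : 0 <= s by rewrite (le_trans _ us).
apply: hT; have A0 := alpha_ge0 s; set A := alpha s in A0 *.
have E : phi (u ^+ 2 + v ^+ 2) = quad u v + (phi (2%:R * u) * x - x ^+ 2).
  by rewrite /quad rmorphD !rmorphXn rmorphM rmorph_nat; ring.
have l1 : A ^+ 2 <= a (phi (u ^+ 2 + v ^+ 2)).
  rewrite -(absX aA) -rmorphXn /=; apply: alpha_mono.
  rewrite normrX (ger0_norm s0) ger0_norm ?addr_ge0 ?sqr_ge0 //.
  exact: sqr_max_norm_le.
have l2 : a (phi (2%:R * u)) <= alpha 2%:R * A.
  rewrite rmorphM (absM aA) ler_wpM2l //; apply: alpha_mono.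
  by rewrite (ger0_norm s0).
have l3 : A ^+ 2 <= C + alpha 2%:R * A * a x + a x ^+ 2.
  apply: (le_trans l1); rewrite E (le_trans (absD aA _ _)) // -addrA lerD //.
  rewrite (le_trans (absB aA _ _)) // (absM aA) (absX aA) lerD2r.
  by rewrite ler_wpM2r ?(abs_ge0 aA).
have := ler_norm C; have := abs_ge0 aA x; have := alpha_ge0 2%:R.
have [A1|A1] := lerP A 1.
  move=> p1 p2 p3; have : 0 <= alpha 2%:R * a x by rewrite mulr_ge0.
  by have := sqr_ge0 (a x); have := normr_ge0 C; lra.
move=> p1 p2 p3.
rewrite -(ler_pM2l (lt_trans ltr01 A1)) -expr2 (le_trans l3) //.
have q1 : C <= A * `|C|.
  by rewrite (le_trans p3) // ler_peMl // ltW.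
have q2 : a x ^+ 2 <= A * a x ^+ 2 by rewrite ler_peMl ?sqr_ge0 // ltW.
lra.
Qed.

Lemma quad_min : exists u0 v0, forall u v, a (quad u0 v0) <= a (quad u v).
Proof. exact: plane_min quad_continuous quad_proper. Qed.

(** The square of [p] is a product of [(size p).-1] real quadratics, each of absolute value at least
    [mu] at [x]. *)
Lemma monic_abs_ge (mu : R) (p : {poly R}) :
  0 <= mu -> (forall u v, mu <= a (quad u v)) -> p \is monic ->
  mu ^+ (size p).-1 <= a (map_poly phi p).[x] ^+ 2.
Proof.
move=> mu0 qmin pm; have [s <- ps] := monic_sqr_quad pm.
rewrite -(absX aA) -horner_exp -rmorphXn /= ps rmorph_prod horner_prod.
elim: s {ps} => [|z s IH]; first by rewrite big_nil expr0 (abs1 aA).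
rewrite big_cons exprS horner_quad_poly (absM aA).
by rewrite ler_pM // exprn_ge0.
Qed.

(* With [w] the value of a quadratic of minimal absolute value [mu], the
   polynomial [w^n - (-e)^n] is [w + e] times a monic polynomial of degree
   [2(n-1)] in [x], whose absolute value is at least [mu^(n-1)]. *)
Lemma quad_shift_bound mu u v e n : 0 < mu ->
  (forall u v, mu <= a (quad u v)) -> a (quad u v) = mu ->
  a (quad u v + phi e) / mu <= 1 + (alpha e / mu) ^+ n.+1.
Proof.
move=> mu0 qmin quv; set w := quad u v.
pose W := quad_poly u v; pose E : {poly R} := (- e)%:P.
have Xm : ('X - u%:P : {poly R}) ^+ 2 \is monic.
  by rewrite monic_exp ?monicXsubC.
have Xs : size (('X - u%:P : {poly R}) ^+ 2) = 3%N by rewrite size_exp_XsubC.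
have quad_monic c : ('X - u%:P) ^+ 2 + c%:P \is monic /\
    size (('X - u%:P) ^+ 2 + c%:P) = 3%N.
  have cs : (size (c%:P : {poly R}) < size (('X - u%:P : {poly R}) ^+ 2))%N.
    by rewrite Xs (leq_ltn_trans (size_polyC_leq1 _)).
  by rewrite monicE lead_coefDl // size_polyDl // Xs (monicP Xm).
have [Wm Ws] := quad_monic (v ^+ 2); rewrite -/(quad_poly u v) -/W in Wm Ws.
have [WEm WEs] : W - E \is monic /\ size (W - E) = 3%N.
  by rewrite /W /E /quad_poly -addrA -polyCB; exact: quad_monic.
have Wn : size (W ^+ n.+1) = ((2 * n.+1).+1)%N.
  rewrite -[LHS]prednK ?size_exp ?Ws //.
  by rewrite size_poly_gt0 expf_neq0 ?monic_neq0.
have Es : (size (- E ^+ n.+1)%R < size (W ^+ n.+1))%N.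
  by rewrite Wn size_polyN -polyC_exp (leq_ltn_trans (size_polyC_leq1 _)).
pose P := \sum_(i < n.+1) W ^+ (n - i) * E ^+ i.
have WP : W ^+ n.+1 - E ^+ n.+1 = (W - E) * P.
  by rewrite subrXX; congr (_ * _); apply: eq_bigr => i _; rewrite subSS.
have Pm : P \is monic.
  rewrite -(monicMl _ WEm) -WP monicE lead_coefDl //.
  by rewrite -monicE monic_exp.
have Ps : (size P).-1 = (2 * n)%N.
  have := size_polyDl Es; rewrite WP size_monicM ?monic_neq0 // WEs Wn.
  by move: (size P) => z; lia.
have Pge := monic_abs_ge (ltW mu0) qmin Pm; rewrite Ps in Pge.
(* [P] has degree [2 * n], so the bound on its square is [mu ^+ (2 * n)]; take square roots. *)
have {}Pge : mu ^+ n <= a (map_poly phi P).[x].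
  rewrite -(ler_pXn2r (n := 2)) //
    ?nnegrE ?exprn_ge0 ?(abs_ge0 aA) ?(ltW mu0) //.
  by rewrite -exprM mulnC.
have ev : w ^+ n.+1 - phi (- e) ^+ n.+1 = (w + phi e) * (map_poly phi P).[x].
  have := congr1 (fun p => (map_poly phi p).[x]) WP.
  rewrite rmorphB rmorphM rmorphB !rmorphXn /= /E map_polyC /= !hornerE.
  by rewrite horner_quad_poly rmorphN opprK.
have up : a (w + phi e) * mu ^+ n <= mu ^+ n.+1 + alpha e ^+ n.+1.
  apply: (@le_trans _ _ (a (w ^+ n.+1 - phi (- e) ^+ n.+1))).
    by rewrite ev (absM aA) ler_wpM2l ?(abs_ge0 aA).
  by rewrite (le_trans (absB aA _ _)) // !(absX aA) rmorphN (absN aA) quv.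
rewrite expr_div_n -(ler_pM2r (exprn_gt0 n.+1 mu0)) mulrDl mul1r.
rewrite divfK ?expf_neq0 ?gt_eqF // exprS mulrA divfK ?gt_eqF //.
by rewrite -exprS.
Qed.

Lemma power_gap (c r : R) :
  0 <= r < 1 -> (forall n, c <= 1 + r ^+ n.+1) -> c <= 1.
Proof.
move=> /andP[r0 r1] cr; rewrite leNgt; apply/negP => c1.
move: r0; rewrite le_eqVlt => /orP[/eqP r0|r0].
  by have := cr 0%N; rewrite -r0 expr1; lra.
have rV : 1 < r^-1 by rewrite invf_gt1.
have [n hn] := geometric_unbounded (c - 1)^-1 rV.
have : c - 1 <= r ^+ n.
  have := cr n; rewrite exprS; have := exprn_ge0 n (ltW r0); nra.
rewrite leNgt => /negP; apply.
by rewrite exprVn ltf_pV2 ?posrE ?exprn_gt0 ?subr_gt0 // in hn.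
Qed.

(** Real square roots absorb a nonnegative translation into [v], so translated values are again
    values of [quad]. *)
Lemma quad_addr u v e : 0 <= e ->
  quad u (Num.sqrt (v ^+ 2 + e)) = quad u v + phi e.
Proof.
move=> e0; rewrite /quad -(rmorphXn phi) sqr_sqrtr ?addr_ge0 ?sqr_ge0 //.
by rewrite rmorphD rmorphXn addrA.
Qed.

(* A positive minimum [mu] would be kept by every translation
   [w + phi (k * e)], although [phi (k * e)] is unbounded in [k]. *)
Lemma quad_root : exists u v, quad u v = 0.
Proof.
have [u [v0 qmin]] := quad_min; exists u, v0; apply/eqP.
rewrite -(abs_eq0 aA); apply: contraT => q0.
set mu := a (quad u v0) in qmin q0.
have mu0 : 0 < mu by rewrite lt_def q0 (abs_ge0 aA).
have [e e0 esmall] := alpha_small mu0.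
(* The translate is at least [mu] by minimality, and at most [mu] by letting [n] grow in
   [quad_shift_bound], as [alpha e < mu]. *)
have step v : a (quad u v) = mu ->
    exists2 v', quad u v' = quad u v + phi e & a (quad u v') = mu.
  have qE := quad_addr u v (ltW e0).
  move=> qv; exists (Num.sqrt (v ^+ 2 + e)); rewrite // qE.
  apply/eqP; rewrite eq_le; apply/andP; split; last by rewrite -qE.
  rewrite -[leRHS]mul1r -ler_pdivrMr //.
  apply: (@power_gap _ (alpha e / mu)).
    rewrite divr_ge0 ?(ltW mu0) //= ltr_pdivrMr // mul1r esmall //.
    by rewrite (gtr0_norm e0).
  by move=> n; exact: quad_shift_bound.
have iter (k : nat) : exists2 v, quad u v = quad u v0 + phi (k%:R * e) &
    a (quad u v) = mu.
  elim: k => [|k [v qv av]]; first by exists v0; rewrite // mul0r rmorph0 addr0.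
  have [v' qv' av'] := step _ av; exists v' => //.
  by rewrite qv' qv -natr1 mulrDl mul1r rmorphD addrA.
have [T hT] := alpha_large (2%:R * mu).
have bound (k : nat) : k%:R * e <= T.
  apply: le_trans (ler_norm _) _; apply: hT.
  have [v qv av] := iter k.
  have -> : phi (k%:R * e) = quad u v - quad u v0 by rewrite qv addrC addKr.
  by rewrite (le_trans (absB aA _ _)) // av -/mu mulr_natl mulr2n.
have T0 : 0 <= T by have := bound 0%N; rewrite mul0r.
have := bound (Num.bound (T / e)); rewrite -ler_pdivlMr // leNgt.
by rewrite archi_boundP // divr_ge0 // ltW.
Qed.

End Quadratics.

(** Every [x] is a zero of some [quad]. For [x0] outside the image of [phi] this zero has [v != 0]
    and yields [i]; then each equation factors as a difference of squares. *)
Lemma real_or_complex :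
  (forall x, exists u, x = phi u) \/
  exists2 i : K, i ^+ 2 = - 1 & forall x, exists u v, x = phi u + i * phi v.
Proof.
have [real|] := pselect (forall x, exists u, x = phi u); first by left.
move/existsNP => [x0 x0R]; right.
have [u [v]] := quad_root x0; rewrite /quad.
have [->|v0] := eqVneq v 0.
  rewrite rmorph0 expr0n addr0 => /eqP; rewrite sqrf_eq0 subr_eq0 => /eqP xu.
  by case: x0R; exists u.
have pv0 : phi v != 0 by rewrite fmorph_eq0.
move=> q0; pose i := (x0 - phi u) / phi v.
have i2 : i ^+ 2 = - 1.
  have q1 : (x0 - phi u) ^+ 2 = - phi v ^+ 2 by rewrite -(addr0_eq q0) opprK.
  by rewrite /i expr_div_n q1 mulNr divff // expf_neq0.
exists i => //.
move=> x; have [s [t]] := quad_root x; rewrite /quad => q.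
have : (x - phi s) ^+ 2 == (i * phi t) ^+ 2.
  by rewrite exprMn i2 mulN1r -addr_eq0 q.
rewrite eqf_sqr => /orP[]; rewrite subr_eq => /eqP ->.
  by exists s, t; rewrite addrC.
by exists s, (- t); rewrite rmorphN mulrN addrC.
Qed.

(** Multiply [phi u + i * phi v] by its conjugate, which is at most [2 * alpha s] for [s] the
    maximum. The product is the image of [u ^+ 2 + v ^+ 2], at least [alpha s ^+ 2]; cancel
    [alpha s]. *)
Lemma coordinates_le (i : K) u v : i ^+ 2 = - 1 ->
  alpha (Num.max `|u| `|v|) <= 2%:R * a (phi u + i * phi v).
Proof.
move=> i2; have ai : a i = 1.
  have : a i ^+ 2 == 1 by rewrite -(absX aA) i2 (absN aA) (abs1 aA).
  rewrite sqrf_eq1 => /orP[/eqP //|/eqP ai].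
  by have := abs_ge0 aA i; rewrite ai; lra.
set s := Num.max _ _.
have us : `|u| <= s by rewrite le_max lexx.
have vs : `|v| <= s by rewrite le_max lexx orbT.
have s0 : 0 <= s by rewrite (le_trans _ us).
have [->|sn0] := eqVneq s 0.
  by rewrite rmorph0 (abs0 aA) mulr_ge0 ?(abs_ge0 aA).
have A0 : 0 < alpha s by rewrite (abs_gt0 aA) fmorph_eq0.
have lo : alpha s ^+ 2 <= a (phi (u ^+ 2 + v ^+ 2)).
  rewrite -(absX aA) -rmorphXn /=; apply: alpha_mono.
  rewrite normrX (ger0_norm s0) ger0_norm ?addr_ge0 ?sqr_ge0 //.
  exact: sqr_max_norm_le.
have conj : phi (u ^+ 2 + v ^+ 2) = (phi u + i * phi v) * (phi u - i * phi v).
  by rewrite rmorphD !rmorphXn [RHS]mulrC -subr_sqr exprMn i2 mulN1r opprK.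
have up : a (phi u - i * phi v) <= 2%:R * alpha s.
  rewrite (le_trans (absB aA _ _)) // (absM aA) ai mul1r mulr_natl mulr2n.
  by rewrite lerD // alpha_mono // (ger0_norm s0).
rewrite -(ler_pM2r A0) -expr2 (le_trans lo) // conj (absM aA).
rewrite [leRHS](_ : _ = a (phi u + i * phi v) * (2%:R * alpha s)); last by ring.
by rewrite ler_wpM2l ?(abs_ge0 aA).
Qed.

End GelfandMazur.

(** * Transfer of bounded acyclicity from the reals *)

Section Transfer.
Variables (G : group) (K : fieldType) (a : K -> R).
Hypothesis aA : is_absolute_value a.
Variable phi : {additive R -> K}.
Hypothesis phi_bounded :
  forall T, exists C, forall t, `|t| <= T -> a (phi t) <= C.

Definition bounded_coordinate (s : K -> R) : Prop :=
  {morph s : x y / x - y} /\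
  forall C, exists T, forall x, a x <= C -> `|s x| <= T.

Lemma bar_coboundary_additive (U V : zmodType) n (h : {additive U -> V})
    (F : ('I_n -> G) -> U) g :
  bar_coboundary (fun x => h (F x)) g = h (bar_coboundary F g).
Proof.
by rewrite /bar_coboundary raddf_sum; apply: eq_bigr => i _; rewrite raddfMz.
Qed.

Lemma coordinate_primitive s m (F : ('I_m.+1 -> G) -> K) :
  boundedly_acyclic G Rabsval -> bounded_coordinate s ->
  (exists C, forall g, a (F g) <= C) -> (forall g, bar_coboundary F g = 0) ->
  exists2 H : ('I_m -> G) -> R, (exists T, forall g, `|H g| <= T) &
    forall g, s (F g) = bar_coboundary H g.
Proof.
move=> acyc [sB sb] [C FC] F0.
pose sA := HB.pack_for {additive K -> R} s
  (GRing.isZmodMorphism.Build K R s sB).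
have [T hT] := sb C.
have /bcoh_vanishes_bar/(_ (fun g => s (F g)))[||H HT sH] := @acyc m.
- by exists T => g; exact: hT.
- by move=> g; rewrite (bar_coboundary_additive sA) F0 (raddf0 sA).
by exists H.
Qed.

(** Each coordinate of the cocycle has a bounded real primitive; these recombine through [phi] and
    [i]. A copy of the reals is covered by [s2 = 0] and [i = 0]. *)
Lemma two_coordinates_boundedly_acyclic (s1 s2 : K -> R) (i : K) :
  boundedly_acyclic G Rabsval ->
  bounded_coordinate s1 -> bounded_coordinate s2 ->
  (forall x, x = phi (s1 x) + i * phi (s2 x)) ->
  boundedly_acyclic G a.
Proof.
move=> acyc s1c s2c dec m; apply/bcoh_vanishes_bar => F FC F0.
have [H1 [T1 H1T] sH1] := coordinate_primitive acyc s1c FC F0.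
have [H2 [T2 H2T] sH2] := coordinate_primitive acyc s2c FC F0.
have [C1 hC1] := phi_bounded T1; have [C2 hC2] := phi_bounded T2.
exists (fun g => phi (H1 g) + i * phi (H2 g)).
  exists (C1 + a i * C2) => g; rewrite (le_trans (absD aA _ _)) // (absM aA).
  by rewrite lerD ?hC1 // ler_wpM2l ?(abs_ge0 aA) ?hC2.
move=> g; rewrite [LHS]dec sH1 sH2 -!bar_coboundary_additive.
rewrite /bar_coboundary mulr_sumr -big_split; apply: eq_bigr => j _ /=.
by rewrite mulrzDl mulrzAr.
Qed.

End Transfer.

Lemma archimedean_boundedly_acyclic (G : group) (K : fieldType) (a : K -> R)
    (m : nat) :
  is_absolute_value a -> abs_complete a -> 1 < a m%:R ->
  boundedly_acyclic G Rabsval -> boundedly_acyclic G a.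
Proof.
move=> aA a_complete am acyc.
have [phi [D phiD]] := real_embedding aA a_complete am.
have phi_bounded T : exists C, forall t, `|t| <= T -> a (phi t) <= C.
  exists (a (phi T)) => t tT; apply: (alpha_mono aA phiD).
  by rewrite (le_trans tT) // ler_norm.
have phi_inj : injective phi := fmorph_inj phi.
have large := alpha_large aA phiD am.
have [real|[i i2 cplx]] := real_or_complex aA phiD am.
  have [s sP] := choice real.
  apply: (@two_coordinates_boundedly_acyclic G _ _ aA phi phi_bounded s
    (fun=> 0) 0) => // [||x].
  - split=> [x y|C]; first by apply: phi_inj; rewrite rmorphB -!sP.
    have [T hT] := large C; exists T => x xC; apply: hT.
    by rewrite -sP.
  - split=> [x y|C]; first by rewrite subr0.
    by exists 0 => x _; rewrite normr0.
  - by rewrite mul0r addr0; exact: sP.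
have [s1 /choice[s2 sP]] := choice cplx.
have coord C : exists T, forall x, a x <= C -> `|s1 x| <= T /\ `|s2 x| <= T.
  have [T hT] := large (2%:R * C); exists T => x xC.
  have M0 : 0 <= Num.max `|s1 x| `|s2 x| by rewrite le_max normr_ge0.
  have : `|Num.max `|s1 x| `|s2 x| | <= T.
    apply: hT; apply: le_trans (coordinates_le aA phiD _ _ i2) _.
    by rewrite -sP ler_pM2l.
  by rewrite ger0_norm // ge_max => /andP[].
(* The coordinates come from choice; they are additive because they are unique, as [coordinates_le]
   forces [u] and [v] to vanish when [phi u + i * phi v = 0]. *)
have coordB x y : s1 (x - y) = s1 x - s1 y /\ s2 (x - y) = s2 x - s2 y.
  pose u := s1 (x - y) - (s1 x - s1 y); pose v := s2 (x - y) - (s2 x - s2 y).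
  have uv0 : phi u + i * phi v = 0.
    rewrite /u /v !rmorphB.
    have -> (p q p1 q1 p2 q2 : K) : p - (p1 - p2) + i * (q - (q1 - q2)) =
      (p + i * q) - ((p1 + i * q1) - (p2 + i * q2)) by ring.
    by rewrite -!sP subrr.
  have := coordinates_le aA phiD u v i2; rewrite uv0 (abs0 aA) mulr0.
  have := abs_ge0 aA (phi (Num.max `|u| `|v|)) => p0 p1.
  have /eqP : a (phi (Num.max `|u| `|v|)) = 0 by apply: le_anti; rewrite p0 p1.
  rewrite (abs_eq0 aA) fmorph_eq0 => /eqP mx.
  have : `|u| <= 0 by rewrite -mx le_max lexx.
  have : `|v| <= 0 by rewrite -mx le_max lexx orbT.
  by rewrite !normr_le0 !subr_eq0 => /eqP -> /eqP ->.
apply: (@two_coordinates_boundedly_acyclic G _ _ aA phi phi_bounded s1 s2 i)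
  => //.
  split=> [x y|C]; first by case: (coordB x y).
  by have [T hT] := coord C; exists T => x /hT[].
split=> [x y|C]; first by case: (coordB x y).
by have [T hT] := coord C; exists T => x /hT[].
Qed.

(** * The reals as a complete valued field, and the equivalence *)

Lemma Rabsval_absolute_value : is_absolute_value Rabsval.
Proof.
split=> [x|x|x y|x y]; rewrite /Rabsval ?normr_ge0 ?normrM ?ler_normD //.
by split=> [/normr0_eq0|->]; rewrite ?normr0.
Qed.

Lemma Rabsval_complete : abs_complete Rabsval.
Proof.
move=> u u_cauchy.
(* The supremum of the eventual lower bounds is the limit inferior, which is the limit of a Cauchy
   sequence. *)
pose E : set R := [set x | exists N, forall n, (N <= n)%N -> x <= u n]%classic.
have near e : 0 < e -> exists N, (forall n, (N <= n)%N -> `|u n - u N| <= e) /\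
    `|u N - sup E| <= e.
  move=> /u_cauchy[N uN]; exists N.
  have uNn n : (N <= n)%N -> `|u n - u N| <= e by move=> Nn; apply/ltW/uN.
  have Ele : ubound E (u N + e).
    move=> x [N' xu]; apply: (le_trans (xu (maxn N N') (leq_maxr _ _))).
    by have := uNn _ (leq_maxl N N'); rewrite ler_norml; lra.
  have inE : E (u N - e).
    by exists N => n /uNn; rewrite ler_norml; lra.
  split=> //.
  have l1 : sup E <= u N + e by apply: ge_sup => //; exists (u N - e).
  have l2 : u N - e <= sup E by apply: ub_le_sup => //; exists (u N + e).
  by rewrite ler_norml; lra.
exists (sup E) => e e0.
have [|N [h1 h2]] := near (e / 3); first by rewrite divr_gt0.
exists N => n /h1; move: h2.
rewrite /Rabsval ler_norml ltr_norml ler_norml; lra.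
Qed.

Theorem theorem5p2 (G : group) :
  universally_boundedly_acyclic G <->
  (boundedly_acyclic G Rabsval /\ integrally_acyclic G).
Proof.
split=> [univ|[acycR acycZ] K a aA a_complete].
  split; last exact: universally_acyclic_integrally.
  apply: univ; first exact: Rabsval_absolute_value.
  exact: Rabsval_complete.
(* Either the natural numbers are bounded by [1], which is the non-archimedean case, or some [m]
   with [a m%:R > 1] serves as base for the expansions. *)
have [nat1|] := pselect (forall n : nat, a n%:R <= 1).
  exact: nonarchimedean_boundedly_acyclic.
move=> /existsNP[m /negP]; rewrite -ltNge => am.
exact: archimedean_boundedly_acyclic am acycR.
Qed.
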